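(* Let $D$ be an ultrafilter over some set $I$, and let $K_D^{Reg}$ be the set of those infinite regular cardinals $\nu$ such that $D$ is $\nu$-decomposable. For every GO space $X$, the following conditions are equivalent. (1) $X$ is $D$-compact. (2) $X$ is $[\nu,\nu]$-compact, for every cardinal $\nu\in K_D^{Reg}$. (3) For every cardinal $\nu\in K_D^{Reg}$, and every strictly increasing (resp., strictly decreasing) $\nu$-indexed sequence of elements of $X$, the sequence has a supremum (resp., an infimum) to which it converges. (4) $X$ has neither a gap nor a pseudo-gap of type belonging to $K_D^{Reg}$. (5) $X$ is $D$-pseudocompact. (6) $X$ is weakly $[\nu,\nu]$-compact, for every cardinal $\nu\in K_D^{Reg}$. (7) For every cardinal $\nu\in K_D^{Reg}$, and every sequence $(O_\gamma)_{\gamma<\nu}$ of open nonempty sets of $X$, there is $x\in X$ such that $|\{\gamma<\nu\mid O_\gamma\cap U\neq\emptyset\}|=\nu$ for every neighborhood $U$ of $x$. (In this condition one can equivalently require either that the $O_\gamma$'s are pairwise disjoint, or that $O_\gamma\subset O_{\gamma'}$ for $\gamma>\gamma'$.) (8) $X$ is $D'$-compact, for every ultrafilter $D'$ (over any set) such that $K_{D'}^{Reg}\subseteq K_D^{Reg}$. (9) $X$ is $D'$-pseudocompact, for every ultrafilter $D'$ (over any set) such that $K_{D'}^{Reg}\subseteq K_D^{Reg}$.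
   Context: A GO space (generalized ordered topological space) is a linearly ordered set with a Hausdorff topology having a base of order-convex sets. Ultrafilters are proper. The symbol $\subset$ denotes proper inclusion. If $D$ is an ultrafilter over $I$, a topological space $X$ is $D$-compact if every $I$-indexed sequence $(x_i)_{i\in I}$ of elements of $X$ $D$-converges to some $x\in X$, that is, $\{i\in I\mid x_i\in U\}\in D$ for every open neighborhood $U$ of $x$. $X$ is $D$-pseudocompact if for every sequence $(O_i)_{i\in I}$ of nonempty open sets of $X$ there is $x\in X$ such that $\{i\in I\mid U\cap O_i\neq\emptyset\}\in D$ for every neighborhood $U$ of $x$. An ultrafilter $D$ over $I$ is $\lambda$-decomposable if there is a function $f:I\to\lambda$ such that $f^{-1}(Z)\notin D$ for every $Z\subseteq\lambda$ with $|Z|<\lambda$. For any ultrafilter $D'$, $K_{D'}^{Reg}$ is the set of infinite regular cardinals $\nu$ such that $D'$ is $\nu$-decomposable. A topological space is $[\nu,\lambda]$-compact if every open cover of cardinality $\leq\lambda$ has a subcover of cardinality $<\nu$. It is weakly $[\nu,\lambda]$-compact if every open cover of cardinality $\leq\lambda$ has a subfamily of cardinality $<\nu$ with dense union. A sequence $(x_\gamma)_{\gamma<\lambda}$ converges to $x$ if for every neighborhood $U$ of $x$ there is $\gamma<\lambda$ such that $x_{\gamma'}\in U$ for every $\gamma'>\gamma$ ($\gamma'<\lambda$). Let $X$ be a GO space and consider ordered pairs $(A,B)$ of open subsets of $X$ such that $A\cup B=X$ and $a<b$ for every $a\in A$, $b\in B$. Such a pair is a gap of $X$ if $A$ has no maximum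 and $B$ has no minimum ($A$ or $B$ is allowed to be empty). Such a pair is a pseudo-gap of $X$ if $A$ and $B$ are both nonempty and either $A$ has a maximum and $B$ has no minimum, or $A$ has no maximum and $B$ has a minimum. An infinite cardinal $\lambda$ is a type of a gap $(A,B)$ if either $A$ has cofinality $\lambda$ or $B$ has coinitiality $\lambda$. The type of a pseudo-gap $(A,B)$ is the cofinality of $A$ if $B$ has a minimum, and the coinitiality of $B$ if $A$ has a maximum. *)

(* Defs.v *)
From HB Require Import structures.
From mathcomp Require Import all_boot all_order wochoice.
From mathcomp Require Import all_classical topology.

Set Implicit Arguments.
Unset Strict Implicit.
Unset Printing Implicit Defensive.

Import Order.TTheory.
Local Open Scope order_scope.
Local Open Scope classical_set_scope.
Local Open Scope card_scope.

Definition card_lt T U (A : set T) (B : set U) : Prop :=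
  A #<= B /\ ~ (B #<= A).

Definition order_convex d (T : porderType d) (U : set T) : Prop :=
  forall x y z : T, U x -> U y -> x <= z -> z <= y -> U z.

(* Unlike orderTopologicalType, the topology may be strictly finer than the
   one generated by the open intervals and rays. The order is linear by
   go_total; orderType is not inherited because the library has no join of
   topologicalType and orderType below orderTopologicalType. *)
HB.mixin Record isGOSpace d T & POrderedTopological d T := {
  go_total : total (<=%O : rel T);
  go_hausdorff : hausdorff_space T;
  go_convex_basis : exists2 B : set (set T),
    basis B & forall U, B U -> order_convex U
}.

#[short(type="goSpaceType")]
HB.structure Definition GOSpace d :=
  { T of POrderedTopological d T & isGOSpace d T }.

Section Cofinality.
Context d (T : porderType d).
Implicit Types A C : set T.

Definition has_max A := (A `&` ubound A) !=set0.
Definition has_min A := (A `&` lbound A) !=set0.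

Definition cofinal_in A C :=
  C `<=` A /\ forall a, A a -> exists2 c, C c & a <= c.
Definition coinitial_in A C :=
  C `<=` A /\ forall a, A a -> exists2 c, C c & c <= a.

(* The least cardinality of a cofinal (coinitial) subset of A is that of N. *)
Definition has_cofinality A (N : Type) :=
  (exists2 C, cofinal_in A C & C #= [set: N]) /\
  (forall C, cofinal_in A C -> [set: N] #<= C).
Definition has_coinitiality A (N : Type) :=
  (exists2 C, coinitial_in A C & C #= [set: N]) /\
  (forall C, coinitial_in A C -> [set: N] #<= C).

End Cofinality.

(* A cardinal is represented by any well-ordered type whose order type is an
   initial ordinal; such a type also serves as the index set {g | g < nu}. *)
Definition is_cardinal d (N : orderType d) : Prop :=
  well_order (<=%O : rel N) /\
  forall n : N, card_lt [set m : N | m < n] [set: N].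

Definition is_infinite_regular d (N : orderType d) : Prop :=
  [/\ is_cardinal N, infinite_set [set: N] & has_cofinality [set: N] N].

Definition decomposable I (D : set_system I) (N : Type) : Prop :=
  exists f : I -> N,
    forall Z : set N, card_lt Z [set: N] -> ~ D (f @^-1` Z).

(* [Kreg D N] : the cardinal N belongs to K_D^Reg *)
Definition Kreg I (D : set_system I) d (N : orderType d) : Prop :=
  is_infinite_regular N /\ decomposable D N.

Definition Kreg_sub I' (D' : set_system I') I (D : set_system I) : Prop :=
  forall d (N : orderType d), Kreg D' N -> Kreg D N.

Section Compactness.
Variable X : topologicalType.

Definition D_compact I (D : set_system I) : Prop :=
  forall x : I -> X, exists l : X, x @ D --> l.

Definition D_pseudocompact I (D : set_system I) : Prop :=
  forall O : I -> set X, (forall i, open (O i)) -> (forall i, O i !=set0) ->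
  exists x : X, forall U, nbhs x U -> D [set i | U `&` O i !=set0].

Definition open_cover (C : set (set X)) : Prop :=
  C `<=` open /\ \bigcup_(U in C) U = [set: X].

Definition cardinal_compact (N L : Type) : Prop :=
  forall C : set (set X), open_cover C -> C #<= [set: L] ->
  exists C' : set (set X),
    [/\ C' `<=` C, card_lt C' [set: N] & \bigcup_(U in C') U = [set: X]].

Definition weakly_cardinal_compact (N L : Type) : Prop :=
  forall C : set (set X), open_cover C -> C #<= [set: L] ->
  exists C' : set (set X),
    [/\ C' `<=` C, card_lt C' [set: N] & dense (\bigcup_(U in C') U)].

Definition seq_converges d (N : orderType d) (x : N -> X) (l : X) : Prop :=
  forall U, nbhs l U -> exists g : N, forall g', g < g' -> U (x g').

Definition has_nu_cluster (N : Type) (O : N -> set X) : Prop :=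
  exists x : X, forall U, nbhs x U ->
    [set g | O g `&` U !=set0] #= [set: N].

End Compactness.

Section Gaps.
Context d (X : goSpaceType d).
Implicit Types A B : set X.

Definition is_cut A B : Prop :=
  [/\ open A, open B, A `|` B = [set: X] &
      forall a b, A a -> B b -> a < b].

Definition is_gap A B : Prop :=
  [/\ is_cut A B, ~ has_max A & ~ has_min B].

Definition is_pseudo_gap A B : Prop :=
  [/\ is_cut A B, A !=set0, B !=set0 &
      (has_max A /\ ~ has_min B) \/ (~ has_max A /\ has_min B)].

Definition gap_type A B (N : Type) : Prop :=
  has_cofinality A N \/ has_coinitiality B N.

Definition pseudo_gap_type A B (N : Type) : Prop :=
  (has_min B /\ has_cofinality A N) \/ (has_max A /\ has_coinitiality B N).

End Gaps.

(* Main.v *)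
Require Import Defs.
From HB Require Import structures.
From mathcomp Require Import all_boot all_order.
From mathcomp Require Import all_classical topology.
From mathcomp Require Import wochoice.

Set Implicit Arguments.
Unset Strict Implicit.
Unset Printing Implicit Defensive.

Import Order.TTheory.
Local Open Scope order_scope.
Local Open Scope classical_set_scope.
Local Open Scope card_scope.

(** Everything revolves around cuts [(A, B)] of the GO space into two open
pieces. Call [X] cut-free for [N] when no cut has a lower part of cofinality
[N] or an upper part of coinitiality [N]. For an infinite [N] this is the
absence of gaps and pseudo-gaps of type [N]: a set of infinite cofinality has
no maximum, and [B] either has a minimum or has not.

Cut-freeness gives compactness. Suppose that [x : I -> X] does not
[D]-converge. Then no point is the [D]-typical value of [x], so each point [p]
has [p < x i] for [D]-most [i] or [x i < p] for [D]-most [i]; convex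
neighborhoods show that both sets of points are open, so they form a cut
[(A, B)]. Say that [x i] lies in [A] for [D]-most [i]. Then [A] has no maximum
and its cofinality is an infinite regular cardinal [N]
([regular_cofinality]). Sending [i] to an index of a term above [x i] in a
cofinal [N]-sequence of [A] witnesses that [D] is [N]-decomposable, since a set
of fewer than [N] indices only gives terms below one fixed [a] in [A], whereas
[a < x i] for [D]-most [i] ([cofinality_decomposable]). So [N] is in
[K_D^Reg], and cut-freeness is contradicted. The argument only uses the
regular cardinals for which the ultrafilter at hand is decomposable, hence it
applies to every [D'] with [K_D'^Reg] included in [K_D^Reg].

Conversely, [D]-compactness and [D]-pseudocompactness give [N]-compactness and
weak [N]-compactness for [N]-decomposable [D] in any topological space: a bad
cover yields points (or open sets) escaping its initial subfamilies, and these
are pulled back along a decomposition. Weak [N]-compactness gives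
cluster points of [N]-sequences of open sets. In a GO space, a cut whose lower
part has cofinality [N] produces disjoint intervals, or a decreasing
sequence of final segments, marching up to the cut without a cluster point; so
the cluster conditions give cut-freeness back.

Finally a strictly increasing [N]-sequence determines the cut between the
points below one of its terms and its upper bounds. The upper set is open as
soon as it has no minimum or its minimum is not the limit of the sequence;
thus cut-freeness gives convergence to the supremum, and the converse
is immediate from a cofinal sequence of the lower part.

Only lower parts are treated directly. The order dual of a GO space is a
GO space with the same topology, and all upper-part statements are instances
over the dual. *)

(** * The dual of a GO space *)

Section DualGOSpace.
Context d (X : goSpaceType d).

HB.instance Definition _ := Topological.copy (X^d) X.

Lemma dual_total : total (<=%O : rel X^d).
Proof. by move=> x y; exact: (@go_total _ X y x). Qed.

Lemma dual_convex_basis : exists2 B : set (set X^d),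
  basis B & forall U, B U -> order_convex U.
Proof.
have [B bB cB] := @go_convex_basis _ X; exists B => // U BU x y z Ux Uy xz zy.
exact: (cB U BU y x z Uy Ux zy xz).
Qed.

HB.instance Definition _ :=
  isGOSpace.Build _ (X^d) dual_total (@go_hausdorff _ X) dual_convex_basis.

End DualGOSpace.

(** * Induction and recursion along a well-order *)

Section WellOrderedRecursion.
Context d (N : orderType d).
Hypothesis woN : well_order (<=%O : rel N).

Lemma wo_least (P : set N) :
  P !=set0 -> exists2 n, P n & forall m, P m -> n <= m.
Proof.
move=> [p Pp]; have [|n [[nP n_min] _]] := woN (A := [pred m | `[< P m >]]).
  by exists p; apply/asboolP.
by exists n; [exact/asboolP | move=> m Pm; apply: n_min; apply/asboolP].
Qed.

Lemma wo_induction (P : set N) :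
  (forall n, (forall m, m < n -> P m) -> P n) -> forall n, P n.
Proof.
move=> IH n; apply: contrapT => nPn.
have [k nPk k_min] := wo_least (ex_intro (~` P) n nPn).
apply: nPk; apply: IH => m mk; apply: contrapT => nPm.
by have := lt_le_trans mk (k_min m nPm); rewrite ltxx.
Qed.

(** The relation [R n S t] sees only the set [S] of the values already taken, so
that a size bound on [S] is the whole hypothesis available for finding the next
value [t]. *)
Lemma wo_recursion T (A : set T) (R : N -> set T -> T -> Prop) :
  (forall n S, S `<=` A -> S #<= [set m | m < n] ->
     exists2 t, A t & R n S t) ->
  exists h : N -> T, forall n, A (h n) /\ R n (h @` [set m | m < n]) (h n).
Proof.
move=> ex; pose ok (n : N) (S : set T) := S `<=` A /\ S #<= [set m | m < n].
(* The recursor must be total, so off the admissible sets it takes the value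
   that suits the empty set. *)
have ex' n S : exists t, ok n S -> A t /\ R n S t.
  have [[SA Sn]|nok] := EM (ok n S).
    by have [t At Rt] := ex n S SA Sn; exists t.
  by have [|t _ _] := ex n set0 (@sub0set _ _) => //; exists t.
have [G GP] := choice (fun nS => ex' nS.1 nS.2).
have wf : well_founded (fun m n : N => m < n).
  by move=> n; apply: (@wo_induction (Acc _)) => {}n IH; constructor.
pose F n (rec : forall m : N, m < n -> T) :=
  G (n, [set t | exists m, exists mn : m < n, rec m mn = t]).
pose h := Fix wf (fun=> T) F.
have hE n : h n = G (n, h @` [set m | m < n]).
  rewrite {1}/h Fix_eq; last first.
    move=> k f g fg; congr F; apply: functional_extensionality_dep => m.
    exact: functional_extensionality_dep.
  congr (G (n, _)); apply/seteqP; split=> t /=.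
    by move=> [m [mn <-]]; exists m.
  by move=> [m mn <-]; exists m, mn.
have hP n : ok n (h @` [set m | m < n]) ->
    A (h n) /\ R n (h @` [set m | m < n]) (h n).
  by move=> /(GP (n, _)); rewrite -hE.
exists h; apply: wo_induction => n IH.
apply: hP; split; last exact: card_image_le.
by move=> _ [m mn <-]; exact: (IH m mn).1.
Qed.

End WellOrderedRecursion.

(** * Cofinal sequences in linear orders *)

Section CofinalSequences.
Context dT (T : porderType dT).
Hypothesis totT : total (<=%O : rel T).
Implicit Types A C : set T.

Lemma total_leNlt (x y : T) : x <= y \/ y < x.
Proof.
have [xy|] := boolP (x <= y); first by left.
have /orP[->//|yx xy] := totT x y; right.
by rewrite lt_neqAle yx andbT; apply: contraNneq xy => ->.
Qed.

Lemma no_max_lt A : ~ has_max A -> forall a, A a -> exists2 b, A b & a < b.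
Proof.
move=> nmax a Aa; apply: contrapT => nb; apply: nmax; exists a; split=> // b Ab.
by have [//|ab] := total_leNlt b a; exfalso; apply: nb; exists b.
Qed.

Lemma non_cofinal_bounded A C : C `<=` A -> ~ cofinal_in A C ->
  exists2 a, A a & forall c, C c -> c < a.
Proof.
move=> CA ncof; apply: contrapT => nb; apply: ncof; split=> // a Aa.
apply: contrapT => nc; apply: nb; exists a => // c Cc.
by have [ac|//] := total_leNlt a c; exfalso; apply: nc; exists c.
Qed.

Lemma cofinal_infinite A C :
  A !=set0 -> ~ has_max A -> cofinal_in A C -> infinite_set C.
Proof.
move=> [a0 Aa0] nmax [CA cof] /finite_seqP[s sE].
have [a Aa sa] : exists2 a, A a & forall x, x \in s -> x <= a.
  have : forall x, x \in s -> A x by move=> x xs; apply: CA; rewrite sE.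
  elim: s {sE} => [_|x s IH sA]; first by exists a0.
  have [y ys|a Aa sa] := IH; first by apply: sA; rewrite inE ys orbT.
  have Ax : A x by apply: sA; rewrite inE eqxx.
  have /orP[xa|ax] := totT x a.
    by exists a => // y; rewrite inE => /predU1P[->//|/sa].
  exists x => // y; rewrite inE => /predU1P[->//|/sa ya].
  exact: le_trans ya ax.
have [b Ab ab] := no_max_lt nmax Aa.
have [c Cc bc] := cof b Ab.
have ca : c <= a by apply: sa; rewrite sE in Cc.
by have := lt_le_trans ab (le_trans bc ca); rewrite ltxx.
Qed.

Context dN (N : orderType dN).
Hypothesis woN : well_order (<=%O : rel N).

(** With [N] standing for its own order type, this says that the cofinality of
[A] is at least that of [N] whenever [N] is an initial ordinal; it is phrased by
initial segments because that is what the recursion provides. *)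
Definition below_cofinality A :=
  forall (n : N) C, cofinal_in A C -> ~ (C #<= [set m : N | m < n]).

Lemma bounded_below_cofinality A (n : N) C : below_cofinality A ->
  C `<=` A -> C #<= [set m : N | m < n] ->
  exists2 a, A a & forall c, C c -> c < a.
Proof. by move=> bA CA Cn; apply: non_cofinal_bounded CA _ => /(bA n). Qed.

(** No comparability of cardinals is involved: recursion builds a strictly
increasing map from [N] into [C], each step being possible because the values
taken so far are too few to be cofinal. *)
Lemma card_le_cofinal A C : below_cofinality A -> cofinal_in A C ->
  [set: N] #<= C.
Proof.
move=> bA [CA cof].
have [|h hP] := wo_recursion woN (A := C)
    (R := fun n S t => forall s, S s -> s < t).
  move=> n S SC Sn.
  have [a Aa Sa] := bounded_below_cofinality bA (subset_trans SC CA) Sn.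
  have [c Cc ac] := cof a Aa.
  by exists c => // s /Sa sa; exact: lt_le_trans sa ac.
have hlt m n : m < n -> h m < h n by move=> mn; apply: (hP n).2; exists m.
have hinj : injective h.
  move=> m n hmn; case: (ltgtP m n) => // /hlt; rewrite hmn ltxx //.
have hN : range h #= [set: N] by exact: inj_card_eq (in2W hinj).
rewrite -(card_le_eql hN).
by apply: subset_card_le => _ [n _ <-]; exact: (hP n).1.
Qed.

(** The intermediate point [c] makes every interval between two terms nonempty,
which a merely increasing sequence would not ensure in a discrete part of [A];
this is what yields disjoint nonempty open intervals. *)
Lemma spaced_cofinal_sequence A C0 : A !=set0 -> ~ has_max A ->
  below_cofinality A -> cofinal_in A C0 -> C0 #<= [set: N] ->
  exists h : N -> T, [/\ forall n, A (h n),
    forall m n, m < n -> exists2 c, h m < c & c < h n &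
    forall a, A a -> exists n, a <= h n].
Proof.
move=> [a0 Aa0] nmax bA [CA cof] CN.
have [e eC] : exists e : N -> T, C0 = range e.
  have /pfcard_geP[C00|/surjfunPex//] := CN.
  by have [c] := cof a0 Aa0; rewrite C00.
have Ae n : A (e n) by apply: CA; rewrite eC; exists n.
have [|h hP] := wo_recursion woN (A := A) (R := fun n S t =>
    e n <= t /\ forall s, S s -> exists2 c, s < c & c < t).
  move=> n S SA Sn; have [a Aa Sa] := bounded_below_cofinality bA SA Sn.
  have [b Ab [ab eb]] : exists2 b, A b & a <= b /\ e n <= b.
    have /orP[ae|ea] := totT a (e n); first by exists (e n).
    by exists a.
  have [t At bt] := no_max_lt nmax Ab.
  exists t => //; split; first exact: le_trans eb (ltW bt).
  by move=> s /Sa sa; exists b => //; exact: lt_le_trans sa ab.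
exists h; split=> [n|m n mn|a Aa]; first exact: (hP n).1.
  by apply: (hP n).2.2; exists m.
have [c] := cof a Aa; rewrite eC => -[n _ <-] ae.
by exists n; exact: le_trans ae (hP n).2.1.
Qed.

End CofinalSequences.


(** * Subsets of a well-ordered type *)

Section WellOrderedSubtype.
Context (T : choiceType) (R : rel T).
Hypothesis woR : well_order R.

Let woR' : wo_chain R (fun=> true).
Proof. exact: withinW woR. Qed.

Lemma well_order_total : total R.
Proof. by move=> x y; exact: (wo_chainW woR'). Qed.

Lemma well_order_anti : antisymmetric R.
Proof. by move=> x y; exact: (wo_chain_antisymmetric woR'). Qed.

Lemma well_order_trans : transitive R.
Proof.
move=> y x z Rxy Ryz.
have [|w [[wE w_min] _]] := woR (A := fun t => t \in [:: x; y; z]).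
  by exists x; exact: mem_head.
have {}w_min t : t \in [:: x; y; z] -> R w t by exact: w_min.
have : w \in [:: x; y; z] by exact: wE.
rewrite !inE => /or3P[] /eqP wE'.
- by rewrite -wE'; apply: w_min; rewrite !inE eqxx !orbT.
- suff -> : x = y by [].
  by apply: well_order_anti; rewrite Rxy -wE' w_min // !inE eqxx.
- suff <- : y = z by [].
  by apply: well_order_anti; rewrite Ryz -wE' w_min // !inE eqxx orbT.
Qed.

Context (P : pred T).
(** The proof of well-ordering is a parameter of the type so that the order
instances can be inferred from it. *)
Definition wo_sub of well_order R := {x : T | P x}.
Local Notation S := (wo_sub woR).
HB.instance Definition _ := Choice.copy S {x : T | P x}.

Let le (x y : S) := R (val x) (val y).
Let le_refl : reflexive le.
Proof. by move=> x; have := well_order_total (val x) (val x); rewrite orbb. Qed.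
Let le_anti : antisymmetric le.
Proof. by move=> x y /well_order_anti/val_inj. Qed.
Let le_trans' : transitive le.
Proof. by move=> y x z; exact: well_order_trans. Qed.
Let le_total : total le.
Proof. by move=> x y; exact: well_order_total. Qed.

HB.instance Definition _ :=
  Order.Le_isPOrder.Build (Order.Disp tt tt) S le_refl le_anti le_trans'.
HB.instance Definition _ :=
  Order.POrder_isTotal.Build (Order.Disp tt tt) S le_total.

Lemma wo_sub_well_order : well_order (<=%O : rel S).
Proof.
apply: antisymmetric_well_order; first exact: le_anti.
move=> A [a Aa].
have [|x [[/asboolP[y Ay <-]] x_min] _] :=
    woR (A := [pred x | `[< exists2 y, y \in A & val y = x >]]).
  by exists (val a); apply/asboolP; exists a.
exists y; split=> // z Az; apply: x_min; apply/asboolP; by exists z.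
Qed.

End WellOrderedSubtype.
(** * Cofinalities are regular cardinals *)

Lemma card_lt_image T U V (f : T -> U) (Z : set T) (W : set V) :
  card_lt Z W -> card_lt (f @` Z) W.
Proof.
move=> [ZW nWZ]; split; first exact: card_le_trans (card_image_le _ _) ZW.
by move=> Wf; apply: nWZ; exact: card_le_trans Wf (card_image_le _ _).
Qed.

Section Cofinality.
Context dT (T : porderType dT).
Hypothesis totT : total (<=%O : rel T).
Implicit Types A C : set T.

Lemma spaced_lt dN (N : orderType dN) (h : N -> T) :
  (forall m n, m < n -> exists2 c, h m < c & c < h n) ->
  forall m n, m < n -> h m < h n.
Proof. by move=> hP m n /hP[c mc cn]; exact: lt_trans mc cn. Qed.

(** Well-order [T] and take the points that precede every [t] whose set of
predecessors is large enough to dominate a cofinal subset of [A]: this is the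
shortest initial segment with that property, or all of [T] if no proper segment
has it. *)
Lemma least_cofinal_well_order A : A !=set0 ->
  exists dN (N : orderType dN), [/\ well_order (<=%O : rel N),
    below_cofinality N A & exists2 C, cofinal_in A C & C #<= [set: N]].
Proof.
move=> [a0 Aa0]; have [R woR] := well_ordering_principle T.
pose below t := [set s | R s t /\ s <> t].
pose P := [set t | exists2 C, cofinal_in A C & C #<= below t].
pose S : pred T := fun s => `[< forall t, P t -> below t s >].
exists (Order.Disp tt tt), (wo_sub S woR); split; first exact: wo_sub_well_order.
  move=> n C cofC Cn.
  have Pn : P (val n).
    exists C => //; apply: card_le_trans Cn _.
    rewrite -(card_le_eql (inj_card_eq (in2W val_inj))).
    apply: subset_card_le => _ [m mn <-]; move: mn => /=.
    rewrite lt_neqAle => /andP[mn le_mn]; split; first exact: le_mn.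
    by move=> /val_inj; apply/eqP.
  by have /asboolP/(_ _ Pn)[] := valP n.
have SN : S #<= [set: wo_sub S woR].
  apply: (card_le_trans _ (card_image_le (val : wo_sub S woR -> T) _)).
  apply: subset_card_le => s Ss; by exists (Sub s Ss).
have [P0|] := pselect (P !=set0).
  have [|t0 [[/asboolP[C cofC Ct0] t0_min] _]] := woR [pred t | `[< P t >]].
    by have [t Pt] := P0; exists t; apply/asboolP.
  exists C => //; apply: card_le_trans (card_le_trans Ct0 _) SN.
  apply: subset_card_le => s [Rst0 st0]; apply/asboolP => t Pt.
  have Rt0t : R t0 t by apply: t0_min; apply/asboolP.
  split; first exact: (well_order_trans woR Rst0).
  by move=> st; apply: st0; apply: (well_order_anti woR); rewrite Rst0 st Rt0t.
move=> nP; exists A; first by split=> // a Aa; exists a.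
apply: card_le_trans SN; apply: subset_card_le => s _; apply/asboolP => t Pt.
by exfalso; apply: nP; exists t.
Qed.

(** The order produced by [least_cofinal_well_order] is regular because a
monotone cofinal map into [A] carries its cofinal subsets to cofinal subsets of
[A], so that [card_le_cofinal] applies to the order itself as well as to
[A]. *)
Lemma regular_cofinality A : A !=set0 -> ~ has_max A ->
  exists dN (N : orderType dN), is_infinite_regular N /\ has_cofinality A N.
Proof.
move=> A0 nmax.
have [dN [N [woN bA [C cofC CN]]]] := least_cofinal_well_order A0.
have [h [Ah h_spaced hcof]] :=
  spaced_cofinal_sequence totT woN A0 nmax bA cofC CN.
have hlt := spaced_lt h_spaced.
have hle m n : m <= n -> h m <= h n.
  by rewrite [m <= n]le_eqVlt => /orP[/eqP->//|/hlt/ltW].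
have NC := card_le_cofinal totT woN bA cofC.
exists dN, N; split; last first.
  split; last by move=> C' cofC'; exact: (card_le_cofinal totT woN bA cofC').
  by exists C => //; rewrite card_eq_le CN NC.
have bN : below_cofinality N [set: N].
  move=> n Z [_ cofZ] Zn; apply: (bA n (h @` Z)).
    split=> [_ [m _ <-]|a /hcof[m am]]; first exact: Ah.
    have [k Zk mk] := cofZ m I.
    by exists (h k); [exists k | exact: le_trans am (hle _ _ mk)].
  exact: card_le_trans (card_image_le _ _) Zn.
split.
- split=> // n; split; first exact: card_leT.
  by move=> Nn; apply: (bA n C cofC); exact: card_le_trans CN Nn.
- move=> finN; apply: (cofinal_infinite totT A0 nmax cofC).
  exact: card_le_finite CN finN.
- split; first by exists setT => //; split=> // n _; exists n.
  by move=> Z cofZ; exact: (card_le_cofinal (@le_total _ N) woN bN cofZ).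
Qed.

Context dN (N : orderType dN).
Hypothesis regN : is_infinite_regular N.

Lemma regular_well_order : well_order (<=%O : rel N).
Proof. by have [[]] := regN. Qed.

Lemma regular_initial (n : N) : ~ ([set: N] #<= [set m : N | m < n]).
Proof. by have [[_ /(_ n)[]]] := regN. Qed.

(** The singleton of a maximum would be cofinal. *)
Lemma has_cofinality_no_max A : has_cofinality A N -> ~ has_max A.
Proof.
move=> [_ cofN] [m [Am m_max]]; have [_ infN _] := regN; apply: infN.
have /card_le_finite : [set: N] #<= [set m].
  by apply: cofN; split=> [_ ->//|a /m_max am]; exists m.
by apply; exact: finite_set1.
Qed.

Lemma regular_inhabited : exists n : N, True.
Proof. by have [_ /infinite_setN0[n _] _] := regN; exists n. Qed.

Lemma has_cofinality_nonempty A : has_cofinality A N -> A !=set0.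
Proof.
move=> [_ cofN]; apply: contrapT => A0; have [n _] := regular_inhabited.
have : [set: N] #<= A by apply: cofN; split=> // a Aa; exists a.
have -> : A = set0.
  by apply/seteqP; split=> // a Aa; exfalso; apply: A0; exists a.
by move/card_le0P => N0; have : set0 n by rewrite -N0.
Qed.

Lemma has_cofinality_spaced A : has_cofinality A N ->
  exists h : N -> T, [/\ forall n, A (h n),
    forall m n, m < n -> exists2 c, h m < c & c < h n &
    forall a, A a -> exists n, a <= h n].
Proof.
move=> cofA; have [[C cofC CN] cofN] := cofA.
apply: (spaced_cofinal_sequence totT regular_well_order _ _ _ cofC).
- exact: has_cofinality_nonempty.
- exact: has_cofinality_no_max.
- move=> n C' /cofN NC' C'n; apply: (@regular_initial n).
  exact: card_le_trans NC' C'n.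
- by move: CN; rewrite card_eq_le => /andP[].
Qed.

Lemma has_cofinality_card_lt A C : has_cofinality A N -> C `<=` A ->
  card_lt C [set: N] -> exists2 a, A a & forall c, C c -> c < a.
Proof.
move=> [_ cofN] CA [_ nNC].
by apply: (non_cofinal_bounded totT CA) => /cofN.
Qed.

End Cofinality.

Section Regular.
Context dN (N : orderType dN).
Hypothesis regN : is_infinite_regular N.

(** This is regularity in its usual form: small subsets of [N] are bounded. *)
Lemma regular_bounded (Z : set N) :
  card_lt Z [set: N] -> exists n, forall z, Z z -> z < n.
Proof.
move=> ltZ; have [_ _ cofN] := regN.
have [n _ Zn] :=
  has_cofinality_card_lt (@le_total _ N) cofN (@subsetT _ Z) ltZ.
by exists n.
Qed.

Lemma regular_no_max (n : N) : exists m, n < m.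
Proof.
have [_ _ cofN] := regN.
have nmax := has_cofinality_no_max regN cofN.
by have [m _ nm] := no_max_lt (@le_total _ N) nmax (I : setT n); exists m.
Qed.

Lemma card_lt_initial (n : N) (Z : set N) :
  (forall z, Z z -> z <= n) -> card_lt Z [set: N].
Proof.
move=> Zn; have [m nm] := regular_no_max n; split; first exact: card_leT.
move=> NZ; apply: (regular_initial regN (n := m)); apply: card_le_trans NZ _.
by apply: subset_card_le => z /Zn zn; exact: le_lt_trans zn nm.
Qed.

Lemma regular_succ (n : N) : exists2 m, n < m & forall k, n < k -> m <= k.
Proof. exact: wo_least (regular_well_order regN) _ (regular_no_max n). Qed.

End Regular.

(** * Compactness from decomposability *)

Section Topological.
Context (X : topologicalType) dN (N : orderType dN).
Hypothesis regN : is_infinite_regular N.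

(** Meant for the properties of covering [X] and of having a dense union: an
initial segment of an enumeration of length [N] has fewer than [N] members, so
no initial segment of it satisfies [P]. *)
Lemma escaping_enumeration (P : set (set (set X))) (C : set (set X)) :
  C #<= [set: N] -> P C ->
  (forall C', C' `<=` C -> card_lt C' [set: N] -> ~ P C') ->
  exists2 e : N -> set X, C = range e & forall n, ~ P (e @` [set m | m < n]).
Proof.
move=> CN PC small; have [n0 _] := regular_inhabited regN.
have /pfcard_geP[C0|/surjfunPex[e eC]] := CN.
  exfalso; apply: (small C) => //; rewrite C0; split; first exact: card_ge0.
  by move/card_le0P => N0; have : set0 n0 by rewrite -N0.
exists e => // n; apply: small.
  by rewrite eC => _ [m _ <-]; exists m.
by apply: card_lt_image; apply: (card_lt_initial regN (n := n)) => m /ltW.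
Qed.

Context I (D : set_system I).
Hypotheses (UD : UltraFilter D) (decD : decomposable D N).

(** Choose [x n] outside the first [n] members of a cover without small
subcover, and let [l] be a [D]-limit of [x \o f], with [f] a decomposition. The
[n]-th member, if it contains [l], contains [x (f i)] for [D]-most [i]; but then
[f i <= n], although [f] takes values in a small set only [D]-rarely. *)
Lemma D_compact_cardinal_compact : D_compact X D -> cardinal_compact X N N.
Proof.
move=> cX C [Copen Ccov] CN; apply: contrapT => nsub.
have [||e eC eP] := @escaping_enumeration
    [set C' | \bigcup_(U in C') U = [set: X]] C CN => //.
  by move=> C' C'C ltC' covC'; apply: nsub; exists C'.
have /choice[x xP] n : exists x : X, forall m, m < n -> ~ e m x.
  apply: contrapT => nx; apply: (eP n); apply/seteqP; split=> // y _.
  apply: contrapT => ny; apply: nx; exists y => m mn emy; apply: ny.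
  by exists (e m) => //; exists m.
have [f fD] := decD; have [l xl] := cX (x \o f).
have [U] : (\bigcup_(U in C) U) l by rewrite Ccov.
rewrite eC => -[n _ <-] enl.
apply: (fD [set m | m <= n]); first exact: (card_lt_initial regN (n := n)).
have : D ((x \o f) @^-1` e n).
  apply: xl; apply: open_nbhs_nbhs; split=> //.
  by apply: Copen; rewrite eC; exists n.
by apply: filterS => i /= eni; rewrite leNgt; apply/negP => /xP.
Qed.

(** Same argument as for [D_compact_cardinal_compact], with nonempty open sets
missing the first [n] members in place of points. *)
Lemma D_pseudocompact_weakly_compact :
  D_pseudocompact X D -> weakly_cardinal_compact X N N.
Proof.
move=> cX C [Copen Ccov] CN; apply: contrapT => nsub.
have [||e eC eP] := @escaping_enumeration
    [set C' | dense (\bigcup_(U in C') U)] C CN => //.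
- by rewrite /= Ccov => O O0 _; rewrite setIT.
- by move=> C' C'C ltC' covC'; apply: nsub; exists C'.
have /choice[O OP] n : exists O : set X, [/\ open O, O !=set0 &
    forall m, m < n -> e m `&` O = set0].
  have /denseNE[O [[x [oO Ox]] Oe]] := eP n.
  exists O; split=> //; first by exists x.
  move=> m mn; apply/seteqP; split=> // y [emy Oy].
  have : (O `&` \bigcup_(U in e @` [set m | m < n]) U) y.
    by split=> //; exists (e m) => //; exists m.
  by rewrite Oe.
have [f fD] := decD.
have [i|i|l xl] := cX (O \o f); try by have [] := OP (f i).
have [U] : (\bigcup_(U in C) U) l by rewrite Ccov.
rewrite eC => -[n _ <-] enl.
apply: (fD [set m | m <= n]); first exact: (card_lt_initial regN (n := n)).
have : D [set i | e n `&` O (f i) !=set0].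
  apply: xl; apply: open_nbhs_nbhs; split=> //.
  by apply: Copen; rewrite eC; exists n.
apply: filterS => i /= [y eOy]; rewrite leNgt; apply/negP => nfi.
have [_ _ /(_ n nfi) eO0] := OP (f i).
by have : set0 y by rewrite -eO0.
Qed.

End Topological.

Section TopologicalTrivial.
Context (X : topologicalType).

Lemma cardinal_compact_weakly (M L : Type) :
  cardinal_compact X M L -> weakly_cardinal_compact X M L.
Proof.
move=> cX C Ccov CL; have [C' [C'C ltC' covC']] := cX C Ccov CL.
by exists C'; split=> //; rewrite covC' => O O0 _; rewrite setIT.
Qed.

Lemma D_compact_pseudocompact I (D : set_system I) : Filter D ->
  D_compact X D -> D_pseudocompact X D.
Proof.
move=> FD cX O _ /choice[x Ox]; have [l xl] := cX x; exists l => U lU.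
have : D (x @^-1` U) by exact: xl.
by apply: filterS => i Ui; exists (x i).
Qed.

(** Without a cluster point, each point has a neighborhood meeting no [O k] with
[k] beyond some [n], so the unions [W n] of the open sets with this
property for [n] form a cover. It is increasing, hence by regularity fewer than
[N] of its members lie in a single [W b], which misses [O b] and so is not
dense. *)
Lemma weakly_compact_cluster dN (N : orderType dN) (O : N -> set X) :
  is_infinite_regular N -> weakly_cardinal_compact X N N ->
  (forall n, open (O n)) -> (forall n, O n !=set0) -> has_nu_cluster O.
Proof.
move=> regN wX oO O0; apply: contrapT => ncl.
pose W n := \bigcup_(U in [set U | open U /\
  forall k, n <= k -> O k `&` U = set0]) U.
have Wcov : open_cover (range W).
  split=> [_ [n _ <-]|]; first by apply: bigcup_open => U [].
  apply/seteqP; split=> // x _; apply: contrapT => nx; apply: ncl.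
  exists x => U xU; apply: contrapT => nUN; apply: nx.
  have [|n Un] := regular_bounded regN (Z := [set g | O g `&` U !=set0]).
    split; first exact: card_leT.
    by move=> NU; apply: nUN; rewrite card_eq_le card_leT.
  exists (W n); first by exists n.
  exists U°; last exact: xU.
  split=> [|k nk]; first exact: open_interior.
  apply/seteqP; split=> // y [Oky /interior_subset Uy].
  by have := Un k (ex_intro _ y (conj Oky Uy)); rewrite ltNge nk.
have [C' [C'W ltC' dC']] := wX _ Wcov (card_image_le _ _).
have /choice[k kP] c : exists n, C' c -> W n = c.
  have [|nC'c] := EM (C' c); first by move/C'W => [n _ <-]; exists n.
  by have [n _] := regular_inhabited regN; exists n.
have [b bP] := regular_bounded regN (card_lt_image k ltC').
have [y [Oby [c C'c cy]]] := dC' (O b) (O0 b) (oO b).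
move: cy; rewrite -(kP c C'c) => -[U [_ Uk] Uy].
have : set0 y by rewrite -(Uk b) //; apply/ltW/bP; exists c.
by [].
Qed.

End TopologicalTrivial.

(** * Order and topology in a GO space *)

Section GOTopology.
Context d (X : goSpaceType d).

Lemma go_leNlt (x y : X) : x <= y \/ y < x.
Proof. exact: total_leNlt (@go_total _ X) x y. Qed.

Lemma go_nbhs_convex (x : X) U : nbhs x U ->
  exists V : set X, [/\ open V, order_convex V, V x & V `<=` U].
Proof.
have [B [Bopen Bnbhs] Bconv] := @go_convex_basis _ X.
move=> /Bnbhs[V [BV Vx] VU].
by exists V; split=> //; [exact: Bopen | exact: Bconv].
Qed.

(** A convex neighborhood of [y < a] that omits [a] lies entirely below [a]. *)
Lemma open_lt (a : X) : open [set y | y < a].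
Proof.
rewrite openE => y /= ya.
have : nbhs y (~` [set a]).
  apply: open_nbhs_nbhs; split; last by move=> /= yE; rewrite yE ltxx in ya.
  apply: closed_openC; apply: accessible_closed_set1.
  exact: hausdorff_accessible (@go_hausdorff _ X).
move=> /go_nbhs_convex[V [oV cV Vy Va]].
apply: (filterS _ (open_nbhs_nbhs (conj oV Vy))) => z Vz /=.
have [az|//] := go_leNlt a z; exfalso; apply: (Va a) => //.
exact: (cV y z a Vy Vz (ltW ya) az).
Qed.

Lemma cut_disjoint (A B : set X) x : is_cut A B -> A x -> ~ B x.
Proof. by move=> [_ _ _ AB] Ax /(AB x x Ax); rewrite ltxx. Qed.

Lemma cut_dual (A B : set X) : is_cut A B -> is_cut (X := X^d) B A.
Proof.
move=> [oA oB AB ltAB]; split=> //; first by rewrite setUC.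
by move=> b a Bb Aa; exact: (ltAB a b Aa Bb).
Qed.

Lemma cut_down_closed (A B : set X) x y : is_cut A B -> A y -> x <= y -> A x.
Proof.
move=> [_ _ AB ltAB] Ay xy; have : (A `|` B) x by rewrite AB.
by move=> [//|Bx]; have := lt_le_trans (ltAB y x Ay Bx) xy; rewrite ltxx.
Qed.

(** The condition on lower parts alone; the condition on upper parts is the
same one over the dual space. *)
Definition cofinality_free (N : Type) :=
  forall A B : set X, is_cut A B -> ~ has_cofinality A N.

End GOTopology.

Lemma open_gt d (X : goSpaceType d) (a : X) : open [set y | a < y].
Proof. exact: (@open_lt _ X^d a). Qed.

Lemma cut_dualK d (X : goSpaceType d) (A B : set X) :
  is_cut (X := X^d) B A -> is_cut A B.
Proof. exact: (@cut_dual _ X^d B A). Qed.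

(** * Cuts, monotone sequences and cluster points *)

Section Gaps.
Context d (X : goSpaceType d) dN (N : orderType dN).
Hypothesis regN : is_infinite_regular N.

Definition gap_free :=
  (~ exists A B : set X, is_gap A B /\ gap_type A B N) /\
  (~ exists A B : set X, is_pseudo_gap A B /\ pseudo_gap_type A B N).

Lemma gap_free_cofinality_free : gap_free ->
  cofinality_free X N /\ cofinality_free X^d N.
Proof.
move=> [ngap npgap]; split=> [A B cut cofA|B A cut coiB].
  have nmaxA := has_cofinality_no_max regN cofA.
  have [minB|nminB] := EM (has_min B); last first.
    by apply: ngap; exists A, B; split=> //; left.
  apply: npgap; exists A, B; split; last by left.
  split=> //; [exact: has_cofinality_nonempty regN _ cofA | | by right].
  by have [b [Bb _]] := minB; exists b.
have nminB : ~ has_min (B : set X) := has_cofinality_no_max regN coiB.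
have {}cut := cut_dualK cut.
have [maxA|nmaxA] := EM (has_max (A : set X)); last first.
  by apply: ngap; exists A, B; split=> //; right.
apply: npgap; exists A, B; split; last by right.
split=> //; [ | exact: has_cofinality_nonempty regN _ coiB | by left].
by have [a [Aa _]] := maxA; exists a.
Qed.

Lemma cofinality_free_gap_free :
  cofinality_free X N -> cofinality_free X^d N -> gap_free.
Proof.
move=> fX fXd; split=> -[A [B [[cut _ _ ]]]].
  by move=> [/fX|/fXd]; apply; eauto using cut_dual.
move=> _ [[_ /fX]|[_ /fXd]]; apply; eauto using cut_dual.
Qed.

(** The supremum of a cofinal sequence in [A] can lie neither in [A], which has
no maximum, nor in [B], which is open and contains no term of the sequence. *)
Lemma supremum_cofinality_free :
  (forall x : N -> X, (forall m n, m < n -> x m < x n) ->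
     exists2 s, supremums (range x) s & seq_converges x s) ->
  cofinality_free X N.
Proof.
move=> sup A B cut cofA.
have [h [Ah hsp hcof]] := has_cofinality_spaced (@go_total _ X) regN cofA.
have [s [s_ub _] hs] := sup h (spaced_lt hsp).
have [oA oB AB _] := cut.
have : (A `|` B) s by rewrite AB.
case=> [As|Bs].
  apply: (has_cofinality_no_max regN cofA); exists s; split=> // a /hcof[n an].
  by apply: le_trans an _; apply: s_ub; exists n.
have [g gB] := hs B (open_nbhs_nbhs (conj oB Bs)).
have [g' gg'] := regular_no_max regN g.
exact: cut_disjoint cut (Ah g') (gB g' gg').
Qed.

(** The points below some [x n] form an open set [A] of cofinality [N], so the
set [B] of upper bounds cannot be open. If [B] had no minimum it would be a
union of open rays; if its minimum [s] were not the limit, some convex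
neighborhood of [s] would contain no term at all, hence lie in [B]. *)
Lemma cofinality_free_supremum : cofinality_free X N ->
  forall x : N -> X, (forall m n, m < n -> x m < x n) ->
     exists2 s, supremums (range x) s & seq_converges x s.
Proof.
move=> fX x xlt.
have xle m n : m <= n -> x m <= x n.
  by rewrite [m <= n]le_eqVlt => /orP[/eqP->//|/xlt/ltW].
have xinj : injective x.
  by move=> m n xmn; case: (ltgtP m n) => // /xlt; rewrite xmn ltxx.
pose A := [set y | exists n, y < x n].
have Ax n : A (x n).
  by have [m nm] := regular_no_max regN n; exists m; exact: xlt.
have cofA : has_cofinality A N.
  have cof : cofinal_in A (range x).
    split=> [_ [n _ <-]//|a [n an]]; exists (x n); last exact: ltW.
    by exists n.
  split; first by exists (range x) => //; exact: inj_card_eq (in2W xinj).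
  move=> C [CA cofC].
  have /choice[k kP] c : exists n, A c -> c < x n.
    have [[n cn]|] := EM (A c); first by exists n.
    by have [n _] := regular_inhabited regN; exists n.
  have [_ _ [_ cofN]] := regN.
  apply: card_le_trans (cofN (k @` C) _) (card_image_le _ _).
  split=> // n _; have [c Cc nc] := cofC _ (Ax n).
  exists (k c); first by exists c.
  rewrite leNgt; apply/negP => /xlt kn.
  by have := lt_trans (le_lt_trans nc (kP c (CA c Cc))) kn; rewrite ltxx.
pose B := ubound (range x).
have oA : open A.
  have -> : A = \bigcup_(n in setT) [set y | y < x n].
    by apply/seteqP; split=> y [n]; [exists n | move=> _ yn; exists n].
  by apply: bigcup_open => n _; exact: open_lt.
have AB : A `|` B = setT.
  apply/seteqP; split=> // y _; have [Ay|nAy] := EM (A y); [by left|right].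
  move=> _ [n _ <-]; have [//|yn] := go_leNlt (x n) y.
  by exfalso; apply: nAy; exists n.
have ltAB a b : A a -> B b -> a < b.
  by move=> [n an] Bb; apply: lt_le_trans an _; apply: Bb; exists n.
have noB : ~ open B by move=> oB; exact: (fX A B).
have [s [Bs s_min]] : has_min B.
  apply: contrapT => nmin; apply: noB.
  have -> : B = \bigcup_(b in B) [set y | b < y].
    apply/seteqP; split=> y.
      move=> By; apply: contrapT => nby; apply: nmin; exists y; split=> // b Bb.
      by have [//|bly] := go_leNlt y b; exfalso; apply: nby; exists b.
    move=> [b Bb by_] _ [n _ <-]; apply: le_trans (ltW by_).
    by apply: Bb; exists n.
  by apply: bigcup_open => b _; exact: open_gt.
exists s; first by split.
move=> U /go_nbhs_convex[V [oV cV Vs VU]].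
have [[n Vn]|nV] := EM (exists n, V (x n)).
  exists n => m nm; apply: VU; apply: (cV (x n) s) => //; first exact/ltW/xlt.
  by apply: Bs; exists m.
exfalso; apply: noB.
have -> : B = V `|` [set y | s < y].
  apply/seteqP; split=> y.
    move=> By; have := s_min y By.
    by rewrite le_eqVlt => /orP[/eqP<-|]; [left | right].
  case=> [Vy|sy]; last first.
    by move=> _ [n _ <-]; apply: le_trans (ltW sy); apply: Bs; exists n.
  move=> _ [n _ <-]; have [//|yn] := go_leNlt (x n) y.
  exfalso; apply: nV; exists n; apply: (cV y s) => //; first exact: ltW.
  by apply: Bs; exists n.
by apply: openU => //; exact: open_gt.
Qed.

(** A point of [A] has a neighborhood bounded by some [h m], which [O k] can
meet only for [k < m]; a point of [B] has the neighborhood [B]. *)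
Lemma no_cluster_in_cut (A B : set X) (h : N -> X) (O : N -> set X) :
  is_cut A B -> (forall m n, m < n -> h m < h n) ->
  (forall a, A a -> exists n, a <= h n) ->
  (forall n, O n `<=` A `&` [set y | h n < y]) -> ~ has_nu_cluster O.
Proof.
move=> cut hlt hcof OA [x xcl]; have [oA oB AB _] := cut.
have : (A `|` B) x by rewrite AB.
case=> [/hcof[n xn]|Bx].
  have [m nm] := regular_no_max regN n.
  have := xcl [set y | y < h m] _; case/(_ _)/card_eqPle => [|_].
    apply: open_nbhs_nbhs; split; first exact: open_lt.
    exact: le_lt_trans xn (hlt n m nm).
  move=> NO; apply: (regular_initial regN (n := m)); apply: card_le_trans NO _.
  apply: subset_card_le => k [y [/OA[_ /= ky] ym]] /=.
  rewrite ltNge le_eqVlt; apply/negP => /orP[/eqP mk|/hlt mk].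
    by have := lt_trans ky ym; rewrite mk ltxx.
  by have := lt_trans (lt_trans ky ym) mk; rewrite ltxx.
have := xcl B (open_nbhs_nbhs (conj oB Bx)).
have [n0 _] := regular_inhabited regN.
have -> : [set g | O g `&` B !=set0] = set0.
  apply/seteqP; split=> // g [y [/OA[Ay _] By]].
  exact: cut_disjoint cut Ay By.
rewrite card_eq_le => /andP[_ /card_le0P N0].
by have : set0 n0 by rewrite -N0.
Qed.

(** The sets are the intervals between consecutive terms of a spaced cofinal
sequence. *)
Lemma disjoint_cluster_cofinality_free :
  (forall O : N -> set X, (forall n, open (O n)) -> (forall n, O n !=set0) ->
    (forall m n, m <> n -> O m `&` O n = set0) -> has_nu_cluster O) ->
  cofinality_free X N.
Proof.
move=> cl A B cut cofA.
have [h [Ah hsp hcof]] := has_cofinality_spaced (@go_total _ X) regN cofA.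
have hlt := spaced_lt hsp.
have /choice[s sP] (n : N) : exists m : N, n < m /\ forall k, n < k -> m <= k.
  by have [m nm mmin] := regular_succ regN n; exists m.
pose O n := [set y | h n < y] `&` [set y | y < h (s n)].
have Olt m n : m < n -> O m `&` O n = set0.
  move=> mn; apply/seteqP; split=> // y [[_ /= ys] [/= ny _]].
  have := (sP m).2 n mn; rewrite le_eqVlt => /orP[/eqP smn|/hlt smn].
    by have := lt_trans ny ys; rewrite smn ltxx.
  by have := lt_trans (lt_trans ny ys) smn; rewrite ltxx.
apply: (no_cluster_in_cut cut hlt hcof (O := O)).
  move=> n y [ny ys]; split=> //.
  exact: cut_down_closed cut (Ah (s n)) (ltW ys).
apply: cl => [n|n|m n].
- by apply: openI; [exact: open_gt | exact: open_lt].
- by have [c nc cs] := hsp n (s n) (sP n).1; exists c.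
- move=> /eqP; case: (ltgtP m n) => // mn _; first exact: Olt.
  by rewrite setIC; exact: Olt.
Qed.

(** The sets are the final segments of [A] above the terms of a cofinal
sequence. *)
Lemma decreasing_cluster_cofinality_free :
  (forall O : N -> set X, (forall n, open (O n)) -> (forall n, O n !=set0) ->
    (forall m n, n < m -> O m `<` O n) -> has_nu_cluster O) ->
  cofinality_free X N.
Proof.
move=> cl A B cut cofA.
have [h [Ah hsp hcof]] := has_cofinality_spaced (@go_total _ X) regN cofA.
have hlt := spaced_lt hsp; have [oA _ _ _] := cut.
pose O n := A `&` [set y | h n < y].
apply: (no_cluster_in_cut cut hlt hcof (O := O)); first by move=> n y.
apply: cl => [n|n|m n nm].
- by apply: openI => //; exact: open_gt.
- by have [m nm] := regular_no_max regN n; exists (h m); split=> //; exact: hlt.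
- split=> [y [Ay my]|]; first by split=> //; exact: lt_trans (hlt _ _ nm) my.
  by move=> /(_ (h m))[|_ /=]; [split=> //; exact: hlt | rewrite ltxx].
Qed.

End Gaps.

(** * Ultrafilter convergence from the absence of cuts *)

Section Ultrafilters.
Context I (D : set_system I) (UD : UltraFilter D).

(** A map [f] with [x i <= h (f i)] for a cofinal [h] is a decomposition: small
sets of indices give values of [h] bounded by some [a] in [A], while [x]
exceeds [a] on a set of [D]. *)
Lemma cofinality_decomposable dT (T : porderType dT) dN (N : orderType dN)
    (A : set T) (x : I -> T) : total (<=%O : rel T) ->
  is_infinite_regular N -> has_cofinality A N -> D (x @^-1` A) ->
  (forall a, A a -> D [set i | a < x i]) -> decomposable D N.
Proof.
move=> totT regN cofA DA Dlt.
have [h [Ah _ hcof]] := has_cofinality_spaced totT regN cofA.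
have /choice[f fP] i : exists n, A (x i) -> x i <= h n.
  have [/hcof[n xn]|] := EM (A (x i)); first by exists n.
  by have [n _] := regular_inhabited regN; exists n.
exists f => Z ltZ DZ.
have [_ [n _ <-]|a Aa aZ] :=
  has_cofinality_card_lt totT cofA _ (card_lt_image h ltZ); first exact: Ah.
have [i [[Zi Ai] ai]] := filter_ex (filterI (filterI DZ DA) (Dlt a Aa)).
have : h (f i) < a by apply: aZ; exists (f i).
by move=> /(le_lt_trans (fP i Ai))/(lt_trans ai); rewrite ltxx.
Qed.

(** If [V] is a convex neighborhood of [p] that [x] leaves [D]-often and
[p < x i] is outside [V], then [x i] is above all of [V]. *)
Lemma nonconvergent_open d (X : goSpaceType d) (x : I -> X) :
  (forall l : X, ~ x @ D --> l) -> open [set p : X | D [set i | p < x i]].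
Proof.
move=> ncv; rewrite openE => p /= Dp.
have [U pU nDU] : exists2 U : set X, nbhs p U & ~ D (x @^-1` U).
  apply: contrapT => nU; apply: (ncv p) => U pU.
  by apply: contrapT => nDU; apply: nU; exists U.
have [V [oV cV Vp VU]] := go_nbhs_convex pU.
have DnU : D (~` (x @^-1` U)) by have [] := in_ultra_setVsetC (x @^-1` U) UD.
apply: (filterS _ (open_nbhs_nbhs (conj oV Vp))) => q Vq /=.
apply: filterS (filterI Dp DnU) => i [/= pi nUi].
have [xq|//] := go_leNlt (x i) q; exfalso; apply: nUi; apply: VU.
exact: (cV p q _ Vp Vq (ltW pi) xq).
Qed.

(** The values of [x] in [A] exceed any given [a], so [A] has no maximum and its
cofinality belongs to the excluded cardinals. *)
Lemma cofinality_free_eventually d (X : goSpaceType d) (x : I -> X)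
    (A B : set X) :
  (forall dN (N : orderType dN), Kreg D N -> cofinality_free X N) ->
  is_cut A B -> (forall a, A a -> D [set i | a < x i]) -> ~ D (x @^-1` A).
Proof.
move=> free cut Dlt DA.
have [i Ai] := filter_ex DA.
have nmax : ~ has_max A.
  move=> [m [Am m_max]]; have [j [Aj mj]] := filter_ex (filterI DA (Dlt m Am)).
  by have := lt_le_trans mj (m_max _ Aj); rewrite ltxx.
have [dN [N [regN cofA]]] :=
  regular_cofinality (@go_total _ X) (ex_intro A _ Ai) nmax.
apply: (free dN N _ A B cut cofA); split=> //.
exact: cofinality_decomposable (@go_total _ X) regN cofA DA Dlt.
Qed.

(** A non-convergent [x] splits [X] into the points [D]-typically below [x] and
those [D]-typically above [x]. *)
Lemma cofinality_free_D_compact d (X : goSpaceType d) :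
  (forall dN (N : orderType dN), Kreg D N -> cofinality_free X N) ->
  (forall dN (N : orderType dN), Kreg D N -> cofinality_free X^d N) ->
  D_compact X D.
Proof.
move=> freeX freeXd x; apply: contrapT => nl.
have ncv (l : X) : ~ x @ D --> l by move=> xl; apply: nl; exists l.
pose A := [set p : X | D [set i | p < x i]].
pose B := [set p : X | D [set i | x i < p]].
have AB : A `|` B = setT.
  apply/seteqP; split=> // p _.
  have [lt|nlt] := in_ultra_setVsetC [set i | p < x i] UD; first by left.
  have [gt|ngt] := in_ultra_setVsetC [set i | x i < p] UD; first by right.
  exfalso; apply: (ncv p) => U /nbhs_singleton Up.
  suff : D (x @^-1` U) by [].
  apply: filterS (filterI nlt ngt) => i [/= npx nxp].
  suff -> : x i = p by [].
  have [xp|//] := go_leNlt (x i) p; apply/le_anti; rewrite xp /=.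
  by have [//|] := go_leNlt p (x i).
have cut : is_cut A B.
  split=> //; first exact: nonconvergent_open.
    exact: (@nonconvergent_open _ X^d x ncv).
  move=> a b Da Db; have [i [ai ib]] := filter_ex (filterI Da Db).
  exact: lt_trans ai ib.
have [DA|DB] := in_ultra_setVsetC (x @^-1` A) UD.
  exact: (cofinality_free_eventually freeX cut _ DA).
apply: (@cofinality_free_eventually _ X^d x B A freeXd (cut_dual cut)) => //.
apply: filterS DB => i /= nA; have : (A `|` B) (x i) by rewrite AB.
by case.
Qed.

End Ultrafilters.


(** * The equivalences *)

Definition cut_free d (X : goSpaceType d) (N : Type) :=
  cofinality_free X N /\ cofinality_free X^d N.

Lemma weakly_compact_cut_free d (X : goSpaceType d) dN (N : orderType dN) :
  is_infinite_regular N -> weakly_cardinal_compact X N N -> cut_free X N.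
Proof.
move=> regN wX; split; apply: disjoint_cluster_cofinality_free => // O oO O0 _;
  exact: weakly_compact_cluster.
Qed.

Theorem theorem4p1 (I : Type) (D : set_system I) (UD : UltraFilter D)
    (dX : Order.disp_t) (X : goSpaceType dX) :
  [<->
  (* (1) *)
    D_compact X D;
  (* (2) *)
    forall d (N : orderType d), Kreg D N -> cardinal_compact X N N;
  (* (3) *)
    forall d (N : orderType d), Kreg D N -> forall x : N -> X,
      ((forall g g', g < g' -> x g < x g') ->
         exists2 s, supremums (range x) s & seq_converges x s) /\
      ((forall g g', g < g' -> x g' < x g) ->
         exists2 s, infimums (range x) s & seq_converges x s);
  (* (4) *)
    forall d (N : orderType d), Kreg D N ->
      (~ exists A B : set X, is_gap A B /\ gap_type A B N) /\
      (~ exists A B : set X, is_pseudo_gap A B /\ pseudo_gap_type A B N);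
  (* (5) *)
    D_pseudocompact X D;
  (* (6) *)
    forall d (N : orderType d), Kreg D N -> weakly_cardinal_compact X N N;
  (* (7) *)
    forall d (N : orderType d), Kreg D N -> forall O : N -> set X,
      (forall g, open (O g)) -> (forall g, O g !=set0) -> has_nu_cluster O;
  (* (7), for pairwise disjoint sequences *)
    forall d (N : orderType d), Kreg D N -> forall O : N -> set X,
      (forall g, open (O g)) -> (forall g, O g !=set0) ->
      (forall g g', g <> g' -> O g `&` O g' = set0) -> has_nu_cluster O;
  (* (7), for strictly decreasing sequences *)
    forall d (N : orderType d), Kreg D N -> forall O : N -> set X,
      (forall g, open (O g)) -> (forall g, O g !=set0) ->
      (forall g g', g' < g -> O g `<` O g') -> has_nu_cluster O;
  (* (8) *)
    forall (I' : Type) (D' : set_system I'), UltraFilter D' ->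
      Kreg_sub D' D -> D_compact X D';
  (* (9) *)
    forall (I' : Type) (D' : set_system I'), UltraFilter D' ->
      Kreg_sub D' D -> D_pseudocompact X D' ].
Proof.
have compact I' (D' : set_system I') (UD' : UltraFilter D') :
    (forall d (N : orderType d), Kreg D N -> cut_free X N) ->
    Kreg_sub D' D -> D_compact X D'.
  move=> free sub; apply: cofinality_free_D_compact => d N /sub KN.
    by have [] := free d N KN.
  by have [] := free d N KN.
have weak_free (wX : forall d (N : orderType d), Kreg D N ->
    weakly_cardinal_compact X N N) d (N : orderType d) :
    Kreg D N -> cut_free X N.
  by move=> KN; have [regN _] := KN; apply: weakly_compact_cut_free (wX _ N KN).
have pseudo_weak : D_pseudocompact X D ->
    forall d (N : orderType d), Kreg D N -> weakly_cardinal_compact X N N.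
  by move=> pX d N [regN decN]; apply: (D_pseudocompact_weakly_compact regN UD).
tfae.
- by move=> cX d N [regN decN]; apply: (D_compact_cardinal_compact regN UD).
- move=> cX d N KN x; have [regN _] := KN.
  have [freeX freeXd] : cut_free X N.
    apply: weakly_compact_cut_free => //.
    exact/cardinal_compact_weakly/cX.
  by split=> xlt; [apply: cofinality_free_supremum
    | apply: (cofinality_free_supremum (X := X^d))].
- move=> supX d N KN; have [regN _] := KN.
  apply: cofinality_free_gap_free.
    by apply: supremum_cofinality_free => // x; have [] := supX d N KN x.
  by apply: supremum_cofinality_free => // x; have [] := supX d N KN x.
- move=> gapX; apply: D_compact_pseudocompact; apply: compact => // d N KN.
  by have [regN _] := KN; apply: gap_free_cofinality_free (gapX d N KN).
- exact: pseudo_weak.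
- move=> wX d N KN O; have [regN _] := KN.
  exact: weakly_compact_cluster (wX d N KN).
- by move=> clX d N KN O oO O0 _; exact: clX.
- (* Disjoint families say nothing directly about decreasing ones; the way
     leads through cut-freeness and compactness. *)
  move=> clX d N KN O oO O0 _; have [regN _] := KN.
  apply: weakly_compact_cluster => //; apply: pseudo_weak => //.
  apply: D_compact_pseudocompact; apply: compact => // d' N' KN'.
  have [regN' _] := KN'.
  by split; apply: disjoint_cluster_cofinality_free => //; exact: clX.
- move=> clX I' D' UD'; apply: compact => d N KN; have [regN _] := KN.
  by split; apply: decreasing_cluster_cofinality_free => //; exact: clX.
- by move=> cX I' D' UD' sub; apply: D_compact_pseudocompact; exact: cX.
- move=> pX; apply: compact => //; apply: weak_free; apply: pseudo_weak.
  exact: pX.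
Qed.
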